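(* Let $\mu$ be a probability measure on $\mathbb{Z}$ which is not a Dirac mass and such that $\gcd(\mathrm{Supp}(\mu))=1$. Let $\hat\mu(t)=\sum_{k\in\mathbb{Z}}\mu(k)e^{itk}$, and let $G(0,0)=\sum_{n\ge 0}P_0(S_n=0)\in[1,+\infty]$, where $(S_n)_{n\ge0}$ is the homogeneous random walk on $\mathbb{Z}$ with step law $\mu$, started at $0$. Then $$G(0,0)\;\le\;\frac{1}{\pi}\int_0^{2\pi}\mathrm{Re}\left(\frac{1}{1-\hat\mu(t)}\right)dt\;\le\;2\,G(0,0).$$
   Context: The homogeneous random walk with step law $\mu$ is $S_n=X_1+\cdots+X_n$, $S_0=0$, where $(X_i)_{i\ge1}$ are i.i.d. $\mathbb{Z}$-valued random variables with law $\mu$. No moment assumption is made on $\mu$. The function $t\mapsto \mathrm{Re}(1/(1-\hat\mu(t)))$ is positive and continuous on $(0,2\pi)$, and its integral is understood in $[0,+\infty]$; the inequalities are inequalities in $[0,+\infty]$. *)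

(* Defs.v *)
From HB Require Import structures.
From mathcomp Require Import all_boot all_order all_algebra finmap.
From mathcomp Require Import complex.
From mathcomp Require Import all_classical all_reals all_analysis.

Set Implicit Arguments.
Unset Strict Implicit.
Unset Printing Implicit Defensive.

Import Order.TTheory GRing.Theory Num.Theory.

Local Open Scope classical_set_scope.
Local Open Scope ring_scope.

HB.instance Definition _ := isPointed.Build int 0.

(* As the library does for nat: all subsets of int are measurable. *)
HB.instance Definition _ := @isMeasurable.Build default_measure_display
  int (@discrete_measurable int) (discrete_measurable0 (T := int))
  (@discrete_measurableC int) (@discrete_measurableU int).

Definition supp (R : realType) (mu : probability int R) : set int :=
  [set k | (0 < mu [set k])%E].

Definition is_dirac (R : realType) (mu : probability int R) : Prop :=
  exists a : int, forall A : set int, mu A = \d_a A.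

(* [g] is the gcd of a possibly infinite set of integers, with [g >= 0]. *)
Definition is_gcd (A : set int) (g : int) : Prop :=
  [/\ 0 <= g,
      forall k, A k -> (g %| k)%Z
    & forall e : int, (forall k, A k -> (e %| k)%Z) -> (e %| g)%Z].

Definition expi (R : realType) (x : R) : R[i] := (cos x +i* sin x)%C.

(* Sum of an absolutely summable family over Z, as a Lebesgue integral against
   the counting measure, separately for the real and the imaginary part. *)
Definition sumZ (R : realType) (f : int -> R[i]) : R[i] :=
  ((\int[@counting int R]_(k in setT) complex.Re (f k))
   +i* (\int[@counting int R]_(k in setT) complex.Im (f k)))%C.

(* The Fourier transform t |-> sum_k mu(k) e^{itk}. *)
Definition fourier (R : realType) (mu : probability int R) (t : R) : R[i] :=
  sumZ (fun k : int => (fine (mu [set k]))%:C%C * expi (t * k%:~R)).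

Definition mutually_independent d d' (T : measurableType d)
    (T' : measurableType d') (R : realType) (P : probability T R)
    (X : nat -> {RV P >-> T'}) : Prop :=
  forall (J : {fset nat}) (A : nat -> set T'),
    (forall j, measurable (A j)) ->
    P (\bigcap_(j in [set` J]) (X j @^-1` A j)) =
    (\prod_(j <- J) P (X j @^-1` A j))%E.

Definition iid_with_law d d' (T : measurableType d) (T' : measurableType d')
    (R : realType) (P : probability T R) (X : nat -> {RV P >-> T'})
    (mu : probability T' R) : Prop :=
  mutually_independent X /\
  forall i (A : set T'), measurable A -> distribution P (X i) A = mu A.

(* The steps are indexed from 0: [X 0] is the first step. *)
Definition walk d (T : measurableType d) (R : realType) (P : probability T R)
    (X : nat -> {RV P >-> int}) (n : nat) (w : T) : int :=
  \sum_(i < n) X i w.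

Definition green00 d (T : measurableType d) (R : realType)
    (P : probability T R) (X : nat -> {RV P >-> int}) : \bar R :=
  (\sum_(0 <= n <oo) P [set w | walk X n w = 0%R])%E.

(* Main.v *)
(** Write u_r for the Fourier coefficients of 1 / (1 - r mu^), 0 <= r < 1. They
    satisfy u_r = delta_0 + r mu * u_r, hence u_r(0) = sum_n r^n P(S_n = 0).
    As r -> 1, Fatou's lemma bounds the integral by 2 pi G(0,0): this is the
    upper bound.

    For the lower bound, mass may concentrate at t = 0 in the limit, so one works
    with (1 - cos tx) Re (1 / (1 - r mu^)), which is bounded uniformly in r
    because 1 - cos tx <= C (1 - Re mu^(t)) by the gcd condition. Its integral is
    pi (2 u_r(0) - u_r(x) - u_r(-x)), and the maximum principle for mu-convolution
    bounds the bracket from below by g(0) - g(-x), where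
    g(y) = sum_{n < N} r^n P(S_n = y). Averaging over x = i - j with
    0 <= i, j < M turns 1 - cos tx into 1 minus a Fejer kernel, which is at most
    1, and the mean of g(-x) is at most N / M. Let r -> 1 by dominated
    convergence, then M -> oo and N -> oo. *)

Require Import Defs.
From mathcomp Require Import all_boot all_order all_algebra.
From mathcomp Require Import finmap complex ring lra.
From mathcomp Require Import all_classical all_reals all_analysis.
From mathcomp Require Import measurable_realfun.

Set Implicit Arguments.
Unset Strict Implicit.
Unset Printing Implicit Defensive.

Import Order.TTheory GRing.Theory Num.Theory.
Import numFieldNormedType.Exports.

Local Open Scope classical_set_scope.
Local Open Scope ring_scope.

(** * Expectations of bounded measurable functions *)

Section bounded_measurable.
Context d (T : measurableType d) (R : realType).

(** Such functions are integrable under every probability measure and stable under the operations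
    used below, so every integrability condition reduces to closure lemmas. *)
Definition bmeas (f : T -> R) :=
  measurable_fun setT f /\ exists M, forall x, `|f x| <= M.

Lemma bmeas_cst k : bmeas (fun=> k).
Proof. by split=> //; exists `|k|. Qed.

Lemma bmeasD f g : bmeas f -> bmeas g -> bmeas (fun x => f x + g x).
Proof.
move=> [mf [M fM]] [mg [N gN]]; split; first exact: measurable_funD.
by exists (M + N) => x; rewrite (le_trans (ler_normD _ _))// lerD.
Qed.

Lemma bmeasM f g : bmeas f -> bmeas g -> bmeas (fun x => f x * g x).
Proof.
move=> [mf [M fM]] [mg [N gN]]; split; first exact: measurable_funM.
by exists (M * N) => x; rewrite normrM ler_pM.
Qed.

Lemma bmeasZ k f : bmeas f -> bmeas (fun x => k * f x).
Proof. exact/bmeasM/bmeas_cst. Qed.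

Lemma bmeasB f g : bmeas f -> bmeas g -> bmeas (fun x => f x - g x).
Proof.
move=> bf /(bmeasZ (-1)) bg.
rewrite (_ : (fun _ => _) = (fun x => f x + -1 * g x)); first exact: bmeasD.
by apply/funext => x; rewrite mulN1r.
Qed.

(** The inverse has value 0 at 0, as has the real power of exponent -1, which is measurable; zeros
    of f are therefore harmless. *)
Lemma measurable_inv_ge0 (f : T -> R) : measurable_fun setT f ->
  (forall x, 0 <= f x) -> measurable_fun setT (fun x => (f x)^-1).
Proof.
move=> mf f0.
rewrite (_ : (fun _ => _) = (fun x => f x `^ (- 1))).
  exact: (measurableT_comp (measurable_powR (-1 : R)) mf).
by apply/funext => x; rewrite powR_inv1.
Qed.

Lemma bmeasV (f : T -> R) c : 0 < c ->
  measurable_fun setT f -> (forall x, c <= f x) -> bmeas (fun x => (f x)^-1).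
Proof.
move=> c0 mf cf; have f0 x : 0 < f x by exact: lt_le_trans (cf x).
split; first by apply: measurable_inv_ge0 => // x; exact: ltW.
by exists c^-1 => x; rewrite ger0_norm ?lef_pV2 ?posrE// invr_ge0 ltW.
Qed.

Lemma bmeas_sum I (s : seq I) (f : I -> T -> R) :
  (forall i, bmeas (f i)) -> bmeas (fun x => \sum_(i <- s) f i x).
Proof.
move=> bf; elim: s => [|i s ih].
  by under eq_fun do rewrite big_nil; exact: bmeas_cst.
by under eq_fun do rewrite big_cons; exact: bmeasD.
Qed.

Variable m : probability T R.
Implicit Types f g : T -> R.

Lemma bmeas_integrable f : bmeas f -> m.-integrable setT (EFin \o f).
Proof.
move=> [mf [M fM]]; apply: measurable_bounded_integrable => //.
- by rewrite (le_lt_trans (probability_le1 m measurableT)) ?ltry.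
- by exists M; split; [exact: num_real|move=> x Mx y _ /=; rewrite (le_trans _ (ltW Mx))].
Qed.

Lemma EFin_Rintegral f : bmeas f ->
  (\int[m]_x f x)%:E = (\int[m]_x (f x)%:E)%E.
Proof.
move=> bf; rewrite /Rintegral fineK//.
by apply: integrable_fin_num => //; exact: bmeas_integrable.
Qed.

Lemma expectation_cst k : \int[m]_(x in setT) k = k.
Proof. by rewrite (Rintegral_cst m measurableT) /= probability_setT mulr1. Qed.

Lemma expectationD f g : bmeas f -> bmeas g ->
  \int[m]_x (f x + g x) = \int[m]_x f x + \int[m]_x g x.
Proof. by move=> bf bg; rewrite RintegralD//; exact: bmeas_integrable. Qed.

Lemma expectationB f g : bmeas f -> bmeas g ->
  \int[m]_x (f x - g x) = \int[m]_x f x - \int[m]_x g x.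
Proof. by move=> bf bg; rewrite RintegralB//; exact: bmeas_integrable. Qed.

Lemma expectationZ k f : bmeas f ->
  \int[m]_x (k * f x) = k * \int[m]_x f x.
Proof. by move=> bf; rewrite RintegralZl//; exact: bmeas_integrable. Qed.

Lemma le_expectation f g : bmeas f -> bmeas g -> (forall x, f x <= g x) ->
  \int[m]_x f x <= \int[m]_x g x.
Proof. by move=> bf bg fg; apply: le_Rintegral => //; exact: bmeas_integrable. Qed.

Lemma expectation_le f k : bmeas f -> (forall x, f x <= k) ->
  \int[m]_x f x <= k.
Proof.
by move=> bf fk; rewrite -[leRHS]expectation_cst le_expectation//; exact: bmeas_cst.
Qed.

Lemma expectation_norm_le f k : bmeas f -> (forall x, `|f x| <= k) ->
  `|\int[m]_x f x| <= k.
Proof.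
move=> bf fk; rewrite ler_norml -[in leLHS](expectation_cst (- k)).
have fk' x : - k <= f x <= k by rewrite -ler_norml.
rewrite le_expectation//=; [|exact: bmeas_cst|by move=> x; case/andP: (fk' x)].
by apply: expectation_le => // x; case/andP: (fk' x).
Qed.

Lemma expectation_sum I (s : seq I) (f : I -> T -> R) :
  (forall i, bmeas (f i)) ->
  \int[m]_x (\sum_(i <- s) f i x) = \sum_(i <- s) \int[m]_x f i x.
Proof.
move=> bf; elim: s => [|i s ih].
  by under eq_Rintegral do rewrite big_nil; rewrite big_nil expectation_cst.
under eq_Rintegral do rewrite big_cons.
by rewrite big_cons expectationD ?ih//; exact: bmeas_sum.
Qed.

End bounded_measurable.

Lemma bmeas_snd d d' (T : measurableType d) (U : measurableType d')
    (R : realType) (f : U -> R) :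
  bmeas f -> bmeas (fun p : T * U => f p.2).
Proof.
move=> [mf [M fM]]; split; last by exists M.
by apply: measurableT_comp => //; exact: measurable_snd.
Qed.

(** * Fubini's theorem for bounded functions *)

Section bounded_fubini.
Context d d' (T : measurableType d) (U : measurableType d') (R : realType).
Variables (m : probability T R) (n : probability U R) (f : T * U -> R).
Hypothesis bf : bmeas f.

Lemma bmeas_section1 x : bmeas (fun y => f (x, y)).
Proof.
have [mf [M fM]] := bf; split; last by exists M.
by apply: measurableT_comp.
Qed.

Lemma bmeas_section2 y : bmeas (fun x => f (x, y)).
Proof.
have [mf [M fM]] := bf; split; last by exists M.
by apply: measurableT_comp.
Qed.

Let integrable_f : (m \x n)%E.-integrable setT (EFin \o f).
Proof.
have [mf [M fM]] := bf.
have mEf : measurable_fun setT (EFin \o f) by exact/measurable_EFinP.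
apply/integrable12ltyP => //.
apply: (@le_lt_trans _ _ (\int[m]_x (M%:E))%E); last first.
  by rewrite integral_cst//= probability_setT mule1 ltry.
have M0 : 0 <= M by exact: le_trans (fM point).
apply: ge0_le_integral => //=.
- by move=> x _; exact: integral_ge0.
- apply: (measurable_fun_fubini_tonelli_F (fun z => `|(f z)%:E|%E)).
    exact: measurableT_comp.
  by move=> x; exact: abse_ge0.
- move=> x _; rewrite -[leRHS]mule1 -(@probability_setT _ _ _ n) -integral_cst//.
  apply: ge0_le_integral => //.
  + apply/measurable_EFinP; apply: measurableT_comp; first exact: normr_measurable.
    by have [] := bmeas_section1 x.
  + by move=> y _; rewrite /= lee_fin.
Qed.

Lemma bmeas_expectation2 : bmeas (fun x => \int[n]_y f (x, y)).
Proof.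
have [mf [M fM]] := bf; split; last first.
  by exists M => x; apply: expectation_norm_le => //; exact: bmeas_section1.
apply/measurable_EFinP.
rewrite (_ : EFin \o _ = fubini_F n (EFin \o f)); first exact: (measurable_fubini_F integrable_f).
by apply/funext => x /=; rewrite EFin_Rintegral//; exact: bmeas_section1.
Qed.

Lemma bmeas_expectation1 : bmeas (fun y => \int[m]_x f (x, y)).
Proof.
have [mf [M fM]] := bf; split; last first.
  by exists M => y; apply: expectation_norm_le => //; exact: bmeas_section2.
apply/measurable_EFinP.
rewrite (_ : EFin \o _ = fubini_G m (EFin \o f)); first exact: (measurable_fubini_G integrable_f).
by apply/funext => y /=; rewrite EFin_Rintegral//; exact: bmeas_section2.
Qed.

Lemma expectation_swap :
  \int[m]_x \int[n]_y f (x, y) = \int[n]_y \int[m]_x f (x, y).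
Proof.
apply: EFin_inj.
rewrite (EFin_Rintegral _ bmeas_expectation2) (EFin_Rintegral _ bmeas_expectation1).
under eq_integral do rewrite (EFin_Rintegral _ (bmeas_section1 _)).
under [RHS]eq_integral do rewrite (EFin_Rintegral _ (bmeas_section2 _)).
exact: Fubini integrable_f.
Qed.

End bounded_fubini.

(** * Integrals over the integers *)

Section integration_over_int.
Context (R : realType).

(* Each fiber has at most one point, so [ge0_integral_int] below is the series
   expansion of an integral over the countable space int. *)
Definition pickle_fiber (i : nat) : set int := [set k | choice.pickle k = i].

Lemma bigcup_pickle_fiber : \bigcup_i pickle_fiber i = setT.
Proof. by apply/seteqP; split=> // k _; exists (choice.pickle k). Qed.

Lemma trivIset_pickle_fiber : trivIset setT pickle_fiber.
Proof. by move=> i j _ _ [k [/= <- <-]]. Qed.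

Lemma pickle_fiberP i :
  pickle_fiber i = set0 \/ exists k, pickle_fiber i = [set k].
Proof.
have [[k ki]|nk] := pselect (exists k, pickle_fiber i k); last first.
  by left; apply/seteqP; split=> // k ki; apply: nk; exists k.
right; exists k; apply/seteqP; split=> [l li|l ->//].
apply: (pcan_inj (@choice.pickleK int)).
exact: etrans li (esym ki).
Qed.

Lemma ge0_integral_int (nu : {measure set int -> \bar R}) (f : int -> \bar R) :
  (forall k, 0 <= f k)%E ->
  (\int[nu]_k f k = \sum_(0 <= i <oo) \int[nu]_(k in pickle_fiber i) f k)%E.
Proof.
move=> f0; rewrite -[in LHS]bigcup_pickle_fiber ge0_integral_bigcup//.
exact: trivIset_pickle_fiber.
Qed.

Lemma integral_int1 (nu : {measure set int -> \bar R}) (f : int -> \bar R) k :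
  (\int[nu]_(l in [set k]) f l = f k * nu [set k])%E.
Proof.
by rewrite -integral_cst//; apply: eq_integral => l /[!inE] ->.
Qed.

Variable mu : probability int R.

Lemma ge0_integral_counting (f : int -> R) : (forall k, 0 <= f k) ->
  (\int[@counting int R]_k (fine (mu [set k]) * f k)%:E =
   \int[mu]_k (f k)%:E)%E.
Proof.
move=> f0; rewrite !ge0_integral_int//; last first.
  by move=> k; rewrite lee_fin mulr_ge0// fine_ge0.
apply: eq_eseriesr => i _.
have [->|[k ->]] := pickle_fiberP i; first by rewrite !integral_set0.
rewrite !integral_int1 /= /counting asboolT; last exact: finite_set1.
rewrite fset_set1 cardfs1 mule1 EFinM muleC fineK//.
exact: fin_num_measure.
Qed.

(** Turns the sums in [fourier] into expectations under mu. Positive and negative parts are compared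
    separately: the weight is nonnegative, so it comes out of the maximum with 0. *)
Lemma Rintegral_counting (f : int -> R) :
  \int[@counting int R]_k (fine (mu [set k]) * f k) = \int[mu]_k f k.
Proof.
have posE (g : int -> R) :
    (fun k => (g k)%:E)^\+%E = (fun k => (Num.max (g k) 0)%:E).
  by apply/funext => k; rewrite funeposE EFin_max.
have negE (g : int -> R) :
    (fun k => (g k)%:E)^\-%E = (fun k => (Num.max (- g k) 0)%:E).
  by apply/funext => k; rewrite funenegE -EFinN EFin_max.
rewrite /Rintegral integralE [in RHS]integralE !posE !negE.
congr (fine (_ - _)%E).
  rewrite -ge0_integral_counting => [|k]; last by rewrite le_max lexx orbT.
  by apply: eq_integral => k _; rewrite maxr_pMr ?fine_ge0// mulr0.
rewrite -ge0_integral_counting => [|k]; last by rewrite le_max lexx orbT.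
by apply: eq_integral => k _; rewrite -mulrN maxr_pMr ?fine_ge0// mulr0.
Qed.

End integration_over_int.

(** * The uniform law on [0, 2 pi] and orthogonality of cosines *)

Section circle.
Variable R : realType.

Lemma twopi_gt0 : 0 < 2 * pi :> R.
Proof. by rewrite mulr_gt0// pi_gt0. Qed.

Definition circle : probability (measurableTypeR R) R := uniform_prob twopi_gt0.

Lemma integral_circle (f : R -> R) : measurable_fun setT f ->
  (forall t, 0 <= f t) ->
  (\int[circle]_t (f t)%:E =
   ((2 * pi)^-1)%:E * \int[lebesgue_measure]_(t in `]0%R, (2 * pi)%R[) (f t)%:E)%E.
Proof.
move=> mf f0; rewrite integral_uniform//=; last exact/measurable_EFinP.
rewrite subr0 -integral_itv_bndo_bndc; last exact/measurable_EFinP/measurable_funTS.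
by rewrite -integral_itv_obnd_cbnd//; exact/measurable_EFinP/measurable_funTS.
Qed.

Lemma bmeas_cos x : bmeas (fun t : measurableTypeR R => cos (t * x) : R).
Proof.
split; last by exists 1 => t; exact: cos_max.
apply: (@measurableT_comp _ _ _ _ _ _ (@cos R)).
  by apply: continuous_measurable_fun; exact: continuous_cos.
exact: mulrr_measurable.
Qed.

Lemma bmeas_sin x : bmeas (fun t : measurableTypeR R => sin (t * x) : R).
Proof.
split; last by exists 1 => t; exact: sin_max.
apply: (@measurableT_comp _ _ _ _ _ _ (@sin R)).
  by apply: continuous_measurable_fun; exact: continuous_sin.
exact: mulrr_measurable.
Qed.

Lemma sin_twopi_int (x : int) : sin (2 * pi * x%:~R) = 0 :> R.
Proof.
have sin_nat n : sin (2 * pi * n%:R) = 0 :> R.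
  elim: n => [|n ih]; first by rewrite mulr0 sin0.
  by rewrite -[n.+1%:R]natr1 (mulrDr (2 * pi)) mulr1 [X in _ + X]mulr_natl sinD2pi.
by case: x => n; rewrite ?NegzE ?mulrNz ?mulrN ?sinN ?sin_nat ?oppr0.
Qed.

Lemma is_derive_mulr (f : R -> R) (x t df : R) :
  is_derive t 1 f df -> is_derive t 1 (fun u => f u * x) (df * x).
Proof.
move=> fdf; rewrite (_ : (fun _ => _) = x \*: f).
  by rewrite mulrC; exact: is_deriveZ.
by apply/funext => u; rewrite /= mulrC.
Qed.

Lemma circle_cos (x : int) :
  \int[circle]_t cos (t * x%:~R) = (x == 0)%:R.
Proof.
have [->|x0] := eqVneq x 0.
  under eq_Rintegral do rewrite mulr0 cos0.
  exact: expectation_cst.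
have xR0 : x%:~R != 0 :> R by rewrite intr_eq0.
suff : \int[circle]_t (1 + cos (t * x%:~R)) = 1.
  rewrite expectationD ?expectation_cst; [|exact: bmeas_cst|exact: bmeas_cos].
  by move/eqP; rewrite -subr_eq0 addrAC subrr add0r => /eqP.
have b1 : bmeas (fun t : measurableTypeR R => 1 + cos (t * x%:~R) : R).
  by apply: bmeasD; [exact: bmeas_cst|exact: bmeas_cos].
apply: EFin_inj; rewrite EFin_Rintegral// integral_uniform; last first.
- by move=> t; rewrite lee_fin -lerBlDl sub0r cos_geN1.
- by apply/measurable_EFinP; case: b1.
have dF (t : R) : is_derive t 1 (fun t => t + sin (t * x%:~R) / x%:~R)
    (1 + cos (t * x%:~R)).
  have dM : is_derive t 1 (fun t : R => t * x%:~R) x%:~R.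
    by rewrite -[X in is_derive _ _ _ X]mul1r; exact: (is_derive_mulr _ (f := id)).
  have dS : is_derive t 1 (fun t => sin (t * x%:~R)) (cos (t * x%:~R) * x%:~R).
    by apply: (is_derive1_comp (f := sin)); exact: is_derive_sin.
  have := is_deriveD (is_derive_id t 1) (is_derive_mulr (x%:~R^-1) dS).
  by rewrite mulfK.
have cF : continuous (fun t : R => t + sin (t * x%:~R) / x%:~R).
  move=> t; apply: differentiable_continuous; apply/derivable1_diffP.
  by have [] := dF t.
rewrite (@continuous_FTC2 _ _ (fun t => t + sin (t * x%:~R) / x%:~R))//.
- rewrite mul0r sin0 mul0r addr0 sin_twopi_int mul0r addr0 subr0 -EFinB subr0 -EFinM.
  by rewrite mulVf// gt_eqF// twopi_gt0.
- exact: twopi_gt0.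
- apply: continuous_subspaceT => t; apply: cvgD; first exact: cvg_cst.
  apply: continuous_comp; last exact: continuous_cos.
  exact: mulrr_continuous.
- split; first by move=> t _; have [] := dF t.
    exact/cvg_at_right_filter/cF.
  exact/cvg_at_left_filter/cF.
- by move=> t _; rewrite derive1E; have [_ ->] := dF t.
Qed.

End circle.

(** * Real and imaginary parts of the Fourier transform *)

Section characteristic_function.
Variables (R : realType) (mu : probability int R).

Definition char_re (t : R) : R := \int[mu]_k cos (t * k%:~R).
Definition char_im (t : R) : R := \int[mu]_k sin (t * k%:~R).

Lemma fourierE t : fourier mu t = (char_re t +i* char_im t)%C.
Proof.
rewrite /fourier /sumZ /char_re /char_im -!Rintegral_counting.
by congr (_ +i* _)%C; apply: eq_Rintegral => k _; rewrite /= mul0r ?subr0 ?addr0.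
Qed.

(** Re (1 / z) = Re z / |z|^2 with z = 1 - mu^; for z = 0 both sides are 0. *)
Lemma Re_inv_fourier t : complex.Re (1 / (1 - fourier mu t)) =
  (1 - char_re t) / ((1 - char_re t) ^+ 2 + char_im t ^+ 2).
Proof. by rewrite fourierE div1r /= sub0r sqrrN. Qed.

Lemma bmeas_int (f : int -> R) M : (forall k, `|f k| <= M) -> bmeas f.
Proof. by move=> fM; split=> //; exists M. Qed.

Lemma bmeas_cos_int (t : R) : bmeas (fun k : int => cos (t * k%:~R) : R).
Proof. by apply: (@bmeas_int _ 1) => k; exact: cos_max. Qed.

Lemma bmeas_sin_int (t : R) : bmeas (fun k : int => sin (t * k%:~R) : R).
Proof. by apply: (@bmeas_int _ 1) => k; exact: sin_max. Qed.

Lemma measurable_prod_int : measurable_fun setT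
  (fun p : int * measurableTypeR R => p.2 * p.1%:~R : R).
Proof.
apply: measurable_funM; first exact: measurable_snd.
by apply: (@measurableT_comp _ _ _ _ _ _ (fun k : int => k%:~R : R)).
Qed.

Lemma bmeas_cos_prod : bmeas
  (fun p : int * measurableTypeR R => cos (p.2 * p.1%:~R) : R).
Proof.
split; last by exists 1 => p; exact: cos_max.
apply: measurableT_comp measurable_prod_int.
by apply: continuous_measurable_fun; exact: continuous_cos.
Qed.

Lemma bmeas_sin_prod : bmeas
  (fun p : int * measurableTypeR R => sin (p.2 * p.1%:~R) : R).
Proof.
split; last by exists 1 => p; exact: sin_max.
apply: measurableT_comp measurable_prod_int.
by apply: continuous_measurable_fun; exact: continuous_sin.
Qed.

(** Measurability in t comes from Fubini's theorem, applied to the jointly measurable function cos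
    (t k). *)
Lemma bmeas_char_re : bmeas (char_re : measurableTypeR R -> R).
Proof. exact: (bmeas_expectation1 mu (circle R) bmeas_cos_prod). Qed.

Lemma bmeas_char_im : bmeas (char_im : measurableTypeR R -> R).
Proof. exact: (bmeas_expectation1 mu (circle R) bmeas_sin_prod). Qed.

Lemma char_re_le1 t : char_re t <= 1.
Proof. by apply: expectation_le (bmeas_cos_int t) _ => k; exact: cos_le1. Qed.

Lemma char_re_geN1 t : -1 <= char_re t.
Proof.
have /ler_normlP[] : `|char_re t| <= 1; last by rewrite lerNl.
by apply: expectation_norm_le (bmeas_cos_int t) _ => k; exact: cos_max.
Qed.

End characteristic_function.


(** * Fourier coefficients of the resolvent *)

Section resolvent.
Variables (R : realType) (mu : probability int R).
Local Notation a := (char_re mu).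
Local Notation b := (char_im mu).
Implicit Types (r t : R) (x y z : int).

(* [resolvent_re r + i resolvent_im r] is 1 / (1 - r mu^); at the points where
   r mu^ = 1 both are 0, because x / 0 = 0. *)
Definition resolvent_den r t := (1 - r * a t) ^+ 2 + (r * b t) ^+ 2.
Definition resolvent_re r t := (1 - r * a t) / resolvent_den r t.
Definition resolvent_im r t := r * b t / resolvent_den r t.

(* The Fourier coefficients of 1 / (1 - r mu^). For r < 1 they are the Green
   function sum_n r^n P(S_n = x), but only the equation [resolventE] and the
   bound [resolvent_le_partial_green] are needed. *)
Definition resolvent r x : R :=
  \int[circle R]_t (cos (t * x%:~R) * resolvent_re r t +
                    sin (t * x%:~R) * resolvent_im r t).

Definition conv (f : int -> R) y : R := \int[mu]_z f (y - z).

Lemma resolvent0 r : resolvent r 0 = \int[circle R]_t resolvent_re r t.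
Proof.
by apply: eq_Rintegral => t _; rewrite mulr0 cos0 sin0 mul1r mul0r addr0.
Qed.

Lemma resolvent_re_ge0 r t : 0 <= r <= 1 -> 0 <= resolvent_re r t.
Proof.
move=> /andP[r0 r1]; apply: divr_ge0; last by rewrite addr_ge0 ?sqr_ge0.
by rewrite subr_ge0 (le_trans _ r1)// ler_piMr// char_re_le1.
Qed.

Section strict.
Variables (r : R) (r_ge0 : 0 <= r) (r_lt1 : r < 1).

Lemma le_num_re t : 1 - r <= 1 - r * a t.
Proof. by rewrite lerD2l lerN2 ler_piMr// char_re_le1. Qed.

(** As Re mu^ <= 1, the real part of 1 - r mu^ is at least 1 - r > 0. For r < 1 no denominator
    vanishes and the resolvent is bounded in t. *)
Lemma resolvent_den_ge t : (1 - r) ^+ 2 <= resolvent_den r t.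
Proof.
have r1_ge0 : 0 <= 1 - r by rewrite subr_ge0 ltW.
rewrite -[leLHS]addr0 lerD ?sqr_ge0// lerXn2r ?nnegrE ?le_num_re//.
exact: le_trans (le_num_re t).
Qed.

Lemma resolvent_den_neq0 t : resolvent_den r t != 0.
Proof. by rewrite gt_eqF// (lt_le_trans _ (resolvent_den_ge t))// exprn_gt0// subr_gt0. Qed.

Lemma bmeas_num_re : bmeas (fun t : measurableTypeR R => 1 - r * a t).
Proof. apply: bmeasB; [exact: bmeas_cst|exact/bmeasZ/bmeas_char_re]. Qed.

Lemma bmeas_num_im : bmeas (fun t : measurableTypeR R => r * b t).
Proof. exact/bmeasZ/bmeas_char_im. Qed.

Lemma bmeas_den : bmeas (resolvent_den r : measurableTypeR R -> R).
Proof. by apply: bmeasD; apply: bmeasM; (exact: bmeas_num_re || exact: bmeas_num_im). Qed.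

Lemma bmeas_denV : bmeas (fun t : measurableTypeR R => (resolvent_den r t)^-1).
Proof.
apply: (bmeasV (c := (1 - r) ^+ 2)).
- by rewrite exprn_gt0// subr_gt0.
- by case: bmeas_den.
- exact: resolvent_den_ge.
Qed.

Lemma bmeas_resolvent_re : bmeas (resolvent_re r : measurableTypeR R -> R).
Proof. by apply: bmeasM; [exact: bmeas_num_re|exact: bmeas_denV]. Qed.

Lemma bmeas_resolvent_im : bmeas (resolvent_im r : measurableTypeR R -> R).
Proof. by apply: bmeasM; [exact: bmeas_num_im|exact: bmeas_denV]. Qed.

Lemma bmeas_resolvent_integrand (x : R) :
  bmeas (fun t : measurableTypeR R =>
    cos (t * x) * resolvent_re r t + sin (t * x) * resolvent_im r t).
Proof.
apply: bmeasD; apply: bmeasM.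
- exact: bmeas_cos.
- exact: bmeas_resolvent_re.
- exact: bmeas_sin.
- exact: bmeas_resolvent_im.
Qed.

Lemma resolvent_bounded : exists M, forall x, `|resolvent r x| <= M.
Proof.
have [[_ [M AM]] [_ [N BN]]] := (bmeas_resolvent_re, bmeas_resolvent_im).
exists (M + N) => x.
apply: expectation_norm_le; first exact: bmeas_resolvent_integrand.
move=> t; rewrite (le_trans (ler_normD _ _))// (normrM (cos _)) (normrM (sin _)) lerD//.
  by rewrite -[leRHS]mul1r; rewrite ler_pM ?cos_max ?sin_max.
by rewrite -[leRHS]mul1r; rewrite ler_pM ?cos_max ?sin_max.
Qed.

(** The integrand of [resolvent] is Re (e^{-itx} / (1 - r mu^)). By Fubini, convolution by mu
    inserts a factor mu^ inside the real part. *)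
Lemma conv_resolvent x :
  conv (resolvent r) x = \int[circle R]_t
    ((cos (t * x%:~R) * a t + sin (t * x%:~R) * b t) * resolvent_re r t +
     (sin (t * x%:~R) * a t - cos (t * x%:~R) * b t) * resolvent_im r t).
Proof.
(* The integrand at x - z, expanded so that z occurs only in cos (t z) and sin (t z), whose
   expectations are [char_re] and [char_im]. *)
pose h (p : int * measurableTypeR R) : R :=
  (cos (p.2 * x%:~R) * resolvent_re r p.2 +
   sin (p.2 * x%:~R) * resolvent_im r p.2) * cos (p.2 * p.1%:~R) +
  (sin (p.2 * x%:~R) * resolvent_re r p.2 -
   cos (p.2 * x%:~R) * resolvent_im r p.2) * sin (p.2 * p.1%:~R).
have bp := bmeas_resolvent_integrand x%:~R.
have bq : bmeas (fun t : measurableTypeR R =>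
    sin (t * x%:~R) * resolvent_re r t - cos (t * x%:~R) * resolvent_im r t).
  by apply: bmeasB; apply: bmeasM; [exact: bmeas_sin|exact: bmeas_resolvent_re|
    exact: bmeas_cos|exact: bmeas_resolvent_im].
have bh : bmeas h.
  apply: bmeasD; apply: bmeasM.
  - exact: (@bmeas_snd _ _ int (measurableTypeR R) _ _ bp).
  - exact: bmeas_cos_prod.
  - exact: (@bmeas_snd _ _ int (measurableTypeR R) _ _ bq).
  - exact: bmeas_sin_prod.
transitivity (\int[mu]_z \int[circle R]_t h (z, t)).
  apply: eq_Rintegral => z _; apply: eq_Rintegral => t _.
  by rewrite /h/= rmorphB/= mulrBr cosB sinB; ring.
rewrite expectation_swap//; apply: eq_Rintegral => t _.
rewrite /h/= expectationD; last 2 first.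
- exact/bmeasZ/bmeas_cos_int.
- exact/bmeasZ/bmeas_sin_int.
rewrite !expectationZ; [|exact: bmeas_sin_int|exact: bmeas_cos_int].
by rewrite -/(a t) -/(b t); ring.
Qed.

(** Integrated form of 1 / (1 - r mu^) = 1 + r mu^ / (1 - r mu^); the coefficients of the constant 1
    come from [circle_cos]. *)
Lemma resolventE x : resolvent r x = (x == 0)%:R + r * conv (resolvent r) x.
Proof.
rewrite conv_resolvent -circle_cos -expectationZ; last first.
  apply: bmeasD; apply: bmeasM.
  - by apply: bmeasD; apply: bmeasM; [exact: bmeas_cos|exact: bmeas_char_re|
      exact: bmeas_sin|exact: bmeas_char_im].
  - exact: bmeas_resolvent_re.
  - by apply: bmeasB; apply: bmeasM; [exact: bmeas_sin|exact: bmeas_char_re|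
      exact: bmeas_cos|exact: bmeas_char_im].
  - exact: bmeas_resolvent_im.
rewrite -expectationD; [|exact: bmeas_cos|apply: bmeasZ]; last first.
  apply: bmeasD; apply: bmeasM.
  - by apply: bmeasD; apply: bmeasM; [exact: bmeas_cos|exact: bmeas_char_re|
      exact: bmeas_sin|exact: bmeas_char_im].
  - exact: bmeas_resolvent_re.
  - by apply: bmeasB; apply: bmeasM; [exact: bmeas_sin|exact: bmeas_char_re|
      exact: bmeas_cos|exact: bmeas_char_im].
  - exact: bmeas_resolvent_im.
apply: eq_Rintegral => t _.
rewrite /resolvent_re /resolvent_im.
have := resolvent_den_neq0 t; rewrite /resolvent_den => d0.
by field.
Qed.

End strict.
End resolvent.

(** * Convolution by mu and the maximum principle *)

Section potential.
Variables (R : realType) (mu : probability int R).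
Implicit Types (f g : int -> R) (x y z : int).
Local Notation conv := (conv mu).

Definition bounded_int f := exists M, forall k, `|f k| <= M.

Lemma bounded_bmeas f : bounded_int f -> bmeas f.
Proof. by []. Qed.

Lemma bounded_bmeas_conv f y : bounded_int f -> bmeas (fun z => f (y - z)).
Proof. by move=> [M fM]; apply: bounded_bmeas; exists M. Qed.

Lemma bounded_shift f x : bounded_int f -> bounded_int (fun y => f (x + y)).
Proof. by move=> [M fM]; exists M. Qed.

Lemma bounded_conv f : bounded_int f -> bounded_int (conv f).
Proof.
move=> bf; have [M fM] := bf; exists M => k.
exact: expectation_norm_le (bounded_bmeas_conv k bf) _.
Qed.

Lemma bounded_cst c : bounded_int (fun=> c).
Proof. by exists `|c|. Qed.

Lemma bounded_intD f g : bounded_int f -> bounded_int g ->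
  bounded_int (fun y => f y + g y).
Proof. by move=> bf bg; have [] := bmeasD (bounded_bmeas bf) (bounded_bmeas bg). Qed.

Lemma bounded_intB f g : bounded_int f -> bounded_int g ->
  bounded_int (fun y => f y - g y).
Proof. by move=> bf bg; have [] := bmeasB (bounded_bmeas bf) (bounded_bmeas bg). Qed.

Lemma conv_cst c y : conv (fun=> c) y = c.
Proof. exact: expectation_cst. Qed.

Lemma convD f g y : bounded_int f -> bounded_int g ->
  conv (fun y => f y + g y) y = conv f y + conv g y.
Proof. by move=> bf bg; apply: expectationD; exact: bounded_bmeas_conv. Qed.

Lemma convB f g y : bounded_int f -> bounded_int g ->
  conv (fun y => f y - g y) y = conv f y - conv g y.
Proof. by move=> bf bg; apply: expectationB; exact: bounded_bmeas_conv. Qed.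

Lemma conv_shift f x y : conv (fun y => f (x + y)) y = conv f (x + y).
Proof. by apply: eq_Rintegral => z _; rewrite addrA. Qed.

(** A bound f <= M r^n improves to M r^(n+1): off x by the inequality with [conv], at x because f x
    <= 0. Then n tends to infinity. *)
Lemma maximum_principle r f x : 0 <= r < 1 -> bounded_int f ->
  f x <= 0 -> (forall y, y != x -> f y <= r * conv f y) ->
  forall y, f y <= 0.
Proof.
move=> /andP[r0 r1] bf fx0 fr y; have [M fM] := bf.
have M0 : 0 <= M by exact: le_trans (fM 0).
have fle n : forall z, f z <= geometric M r n.
  elim: n => [|n ih] z; first by rewrite /geometric/= expr0 mulr1 (le_trans (ler_norm _)).
  have [->|zx] := eqVneq z x.
    by rewrite (le_trans fx0)// mulr_ge0// exprn_ge0.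
  rewrite (le_trans (fr _ zx))// /geometric/= exprS mulrCA ler_wpM2l//.
  by apply: expectation_le; [exact: bounded_bmeas_conv|move=> k; exact: ih].
have cvg0 : geometric M r @ \oo --> (0 : R).
  by apply: cvg_geometric; rewrite ger0_norm.
rewrite -(cvg_lim _ cvg0)//; apply: limr_ge; first by apply/cvg_ex; exists 0.
by apply: nearW => n; exact: fle.
Qed.

(** The n-fold convolution power of mu; [walk_prob] identifies it with the law of the walk at time
    n. *)
Fixpoint step_prob (n : nat) : int -> R :=
  if n is m.+1 then conv (step_prob m) else fun y => (y == 0)%:R.

Lemma step_prob_ge0 n y : 0 <= step_prob n y.
Proof.
elim: n y => [|n ih] y /=; first exact: ler0n.
by apply: Rintegral_ge0 => z _; exact: ih.
Qed.

Lemma bounded_step_prob n : bounded_int (step_prob n).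
Proof.
elim: n => [|n ih] /=; last exact: bounded_conv.
by exists 1 => k; case: eqP => _; rewrite ?normr1 ?normr0.
Qed.

(** The points j - x are distinct and the total mass is at most 1. The shift x is arbitrary so that
    the induction can absorb a step into it. *)
Lemma sum_step_prob_le1 n x M : \sum_(j < M) step_prob n (j%:Z - x) <= 1.
Proof.
elim: n x => [|n ih] x /=.
  have [[j /eqP jx]|nj] := pselect (exists j : 'I_M, j%:Z == x).
    rewrite (bigD1 j)//= jx subrr eqxx big1 ?addr0// => k kj.
    by rewrite subr_eq0 -jx eqz_nat val_eqE (negbTE kj).
  by rewrite big1// => k _; rewrite subr_eq0; case: eqP => // kx; case: nj; exists k; apply/eqP.
rewrite -expectation_sum => [|j]; last exact/bounded_bmeas_conv/bounded_step_prob.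
apply: expectation_le.
  by apply: bmeas_sum => j; exact/bounded_bmeas_conv/bounded_step_prob.
move=> z; under eq_bigr do rewrite -addrA -opprD.
exact: ih.
Qed.

Definition partial_green r N y : R := \sum_(n < N) r ^+ n * step_prob n y.

Lemma bounded_partial_green r N : bounded_int (partial_green r N).
Proof.
apply: (bmeas_sum (f := fun (n : 'I_N) y => r ^+ n * step_prob n y) _ _).2 => n.
exact/bmeasZ/bounded_bmeas/bounded_step_prob.
Qed.

Lemma partial_greenS r N y :
  partial_green r N.+1 y = (y == 0)%:R + r * conv (partial_green r N) y.
Proof.
rewrite /partial_green big_ord_recl expr0 mul1r; congr (_ + _).
rewrite /conv expectation_sum => [|n]; last first.
  exact/bmeasZ/bounded_bmeas_conv/bounded_step_prob.
rewrite mulr_sumr; apply: eq_bigr => n _.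
rewrite expectationZ; last exact/bounded_bmeas_conv/bounded_step_prob.
by rewrite exprS mulrA.
Qed.

Variables (r : R) (r01 : 0 <= r < 1).
Let r_ge0 : 0 <= r. Proof. by case/andP: r01. Qed.
Let r_lt1 : r < 1. Proof. by case/andP: r01. Qed.
Local Notation u := (resolvent mu r).

Let bu : bounded_int u. Proof. exact: resolvent_bounded. Qed.

(** The right-hand side is the sum with one more term, and that term is nonnegative. *)
Lemma partial_green_le N y :
  partial_green r N y <= (y == 0)%:R + r * conv (partial_green r N) y.
Proof.
rewrite -partial_greenS /partial_green big_ord_recr/= lerDl.
by rewrite mulr_ge0 ?exprn_ge0 ?step_prob_ge0.
Qed.

Lemma partial_green_ge0 N y : 0 <= partial_green r N y.
Proof. by apply: sumr_ge0 => n _; rewrite mulr_ge0 ?exprn_ge0 ?step_prob_ge0. Qed.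

(** Iterating [resolventE] N times produces the partial sum and a remainder, r^N times an average of
    u. *)
Lemma resolvent_le_partial_green C N y : (forall x, `|u x| <= C) ->
  u y <= partial_green r N y + r ^+ N * C.
Proof.
move=> uC; elim: N y => [|N ih] y.
  by rewrite /partial_green big_ord0 add0r mul1r (le_trans (ler_norm _)).
rewrite resolventE// partial_greenS -addrA lerD2l exprS -mulrA -mulrDr ler_wpM2l//.
rewrite -[X in _ <= _ + X](conv_cst _ y) -convD; [|exact: bounded_partial_green|exact: bounded_cst].
apply: le_expectation => [||z]; last exact: ih.
  exact: bounded_bmeas_conv.
apply: (@bounded_bmeas_conv (fun y => _ + _)); apply: bounded_intD (bounded_cst _).
exact: bounded_partial_green.
Qed.

(** Maximum principle for u - u 0: off 0 one has u = r conv u, and - u 0 <= - r u 0 because u 0 is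
    the integral of a nonnegative function. *)
Lemma resolvent_le0 y : u y <= u 0.
Proof.
rewrite -subr_le0.
apply: (maximum_principle (f := fun y => u y - u 0) (x := 0) r01); last 2 first.
- by rewrite subrr.
- move=> {}y y0; rewrite convB//; last exact: bounded_cst.
  rewrite conv_cst {1}resolventE// (negbTE y0) add0r mulrBr lerD2l lerN2.
  rewrite ler_piMl ?(ltW r_lt1)// resolvent0; apply: Rintegral_ge0 => t _.
  by rewrite resolvent_re_ge0// r_ge0 ltW.
- exact: bounded_intB (bounded_cst _).
Qed.

(* The maximum principle is applied, off the point - x, to
   f y = partial_green y - partial_green (- x)
         - (u y - u (x + y) + u 0 - u (- x)),
   which vanishes at - x. *)
Lemma resolvent_symm_ge N x :
  partial_green r N 0 - partial_green r N (- x) <= 2 * u 0 - u x - u (- x).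
Proof.
pose c := - partial_green r N (- x) - u 0 + u (- x).
pose f y := partial_green r N y - u y + u (x + y) + c.
suff : f 0 <= 0 by rewrite /f /c addr0; lra.
have bg := bounded_partial_green r N.
have bgu := bounded_intB bg bu.
have bus := bounded_shift x bu.
have bguu := bounded_intD bgu bus.
(* Gives c <= r c below, since r < 1. *)
have c0 : c <= 0.
  by rewrite /c; have := resolvent_le0 (- x); have := partial_green_ge0 N (- x); lra.
apply: (maximum_principle (f := f) (x := - x) r01).
- exact: bounded_intD (bounded_cst _).
- by rewrite /f /c subrr; lra.
move=> y yx.
rewrite convD//; last exact: bounded_cst.
rewrite conv_cst convD// convB// conv_shift /f.
rewrite (resolventE _ r_ge0 r_lt1 y) (resolventE _ r_ge0 r_lt1 (x + y)).
(* Off - x the translate u (x + y) has no source term; those of [partial_green] and u at 0 cancel in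
   the final inequality. *)
have -> : (x + y == 0) = false by rewrite addrC addr_eq0 (negbTE yx).
rewrite add0r.
have := partial_green_le N y.
have : c <= r * c.
  rewrite -subr_le0 -[X in X - _]mul1r -mulrBl.
  by apply: mulr_ge0_le0; rewrite // subr_ge0 ltW.
lra.
Qed.

End potential.

(** * Subgroups of the integers *)

Section subgroup_of_int.

(** The least positive element of H divides every element of S, because remainders stay in H. It
    then divides the gcd, so it is 1. *)
Lemma is_gcd1_subgroup (S H : set int) : is_gcd S 1 -> S `<=` H -> H 0 ->
  (forall x y, H x -> H y -> H (x - y)) -> forall x, H x.
Proof.
move=> [_ _ S1] SH H0 HB.
have HN x : H x -> H (- x) by rewrite -sub0r; exact: HB.
have HD x y : H x -> H y -> H (x + y).
  by move=> Hx /HN Hy; rewrite -[y]opprK; exact: HB.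
have HMn x n : H x -> H (n%:Z * x).
  move=> Hx; elim: n => [|n ih]; first by rewrite mul0r.
  by rewrite intS mulrDl mul1r; exact: HD.
have HM x z : H x -> H (z * x).
  move=> Hx; case: z => n; first exact: HMn.
  by rewrite NegzE mulNr; apply: HN; exact: HMn.
(* If H has no positive element, then S contains at most 0, and 0 would divide the gcd 1. *)
have [[m /asboolP Hm]|noH] := pselect (exists n, `[< H n.+1%:Z >]); last first.
  have /S1 : forall k, S k -> (0 %| k)%Z.
    move=> k Sk; rewrite dvd0z; apply/negPn/negP => k0.
    apply: noH; exists `|k|%N.-1; apply/asboolP.
    rewrite prednK ?absz_gt0// abszE; case: (ler0P k) => _; last exact: SH.
    exact/HN/SH.
  by rewrite dvd0z.
have exH : exists n, `[< H n.+1%:Z >] by exists m; apply/asboolP.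
have [e /asboolP He emin] := ex_minnP exH.
suff H1 : H 1 by move=> x; rewrite -[x]mulr1; exact: HM.
suff /S1 : forall k, S k -> (e.+1%:Z %| k)%Z.
  by rewrite dvdz1 => /eqP[e0]; move: He; rewrite e0.
move=> k Sk; apply/dvdz_mod0P.
have : H (k %% e.+1%:Z)%Z.
  by rewrite /modz; apply: HB; [exact: SH|exact: HM].
have := modz_ge0 k (isT : e.+1%:Z != 0); have := ltz_pmod k (isT : 0 < e.+1%:Z).
case: (k %% e.+1%:Z)%Z => // -[//|j]; rewrite ltz_nat => je _ Hj.
have : (e <= j)%N by apply: emin; apply/asboolP.
by rewrite leqNgt => /negP; rewrite -ltnS.
Qed.

End subgroup_of_int.

(** * The gcd condition and Fejer averaging *)

Section cosine_defect.
Variables (R : realType) (mu : probability int R).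
Local Notation a := (char_re mu).

(* |uv - 1|^2 <= 2 |u - 1|^2 + 2 |v - 1|^2 for u, v on the unit circle; the two
   squares in the proof add up to |uv - 2v + 1|^2. *)
Lemma cos_defectD (x y : R) :
  1 - cos (x + y) <= 2 * (1 - cos x) + 2 * (1 - cos y).
Proof.
have := cosB (x + y) y; rewrite addrK => ->.
have := cos2Dsin2 (x + y); have := cos2Dsin2 y.
have := sqr_ge0 (cos (x + y) - 2 * cos y + 1).
have := sqr_ge0 (sin (x + y) - 2 * sin y).
move: (cos (x + y)) (sin (x + y)) (cos y) (sin y) => c s c' s'.
nra.
Qed.

Lemma expectation_ge_atom (f : int -> R) k : bmeas f -> (forall z, 0 <= f z) ->
  f k * fine (mu [set k]) <= \int[mu]_z f z.
Proof.
move=> bf f0; rewrite -lee_fin EFin_Rintegral// EFinM fineK; last exact: fin_num_measure.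
rewrite -(integral_int1 mu (EFin \o f)); apply: ge0_subset_integral => //.
by move=> z _; rewrite lee_fin.
Qed.

Lemma one_sub_char_re t : 1 - a t = \int[mu]_z (1 - cos (t * z%:~R)).
Proof.
by rewrite expectationB ?expectation_cst//; [exact: bmeas_cst|exact: bmeas_cos_int].
Qed.

Hypothesis mu_gcd : is_gcd (supp mu) 1.

(* The integers x with this property form a subgroup containing supp mu. *)
Lemma cos_defect_le (x : int) :
  exists C, forall t, 1 - cos (t * x%:~R) <= C * (1 - a t).
Proof.
pose H := [set k : int | exists C, forall t, 1 - cos (t * k%:~R) <= C * (1 - a t)].
apply: (is_gcd1_subgroup (H := H) mu_gcd).
(* On the support the constant is 1 / mu(k): the term z = k alone contributes mu(k) (1 - cos (t k))
   to 1 - Re mu^(t). *)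
- move=> k; rewrite /supp/= => k0; exists (fine (mu [set k]))^-1 => t.
  have mk0 : 0 < fine (mu [set k]).
    by rewrite fine_gt0// k0/= ltey_eq fin_num_measure.
  rewrite ler_pdivlMl// mulrC one_sub_char_re.
  apply: (@expectation_ge_atom (fun z : int => 1 - cos (t * z%:~R))).
    by apply: bmeasB; [exact: bmeas_cst|exact: bmeas_cos_int].
  by move=> z; rewrite subr_ge0 cos_le1.
- by exists 0 => t; rewrite mulr0 cos0 subrr mul0r.
- move=> k l [C kC] [D lD]; exists (2 * C + 2 * D) => t.
  have := cos_defectD (t * k%:~R) (- (t * l%:~R)).
  by rewrite cosN rmorphB/= (mulrBr t); have := kC t; have := lD t; lra.
Qed.

(* One minus a normalized Fejer kernel, whence the values in [0, 1]. *)
Definition fejer_defect (M : nat) (t : R) : R :=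
  (M%:R ^+ 2)^-1 * \sum_(i < M) \sum_(j < M) (1 - cos (t * (i%:Z - j%:Z)%:~R)).

Lemma fejer_defect_ge0 M t : 0 <= fejer_defect M t.
Proof.
rewrite mulr_ge0 ?invr_ge0 ?sqr_ge0//; apply: sumr_ge0 => i _.
by apply: sumr_ge0 => j _; rewrite subr_ge0 cos_le1.
Qed.

(** The double sum of cos (t (i - j)) is |sum_j e^{itj}|^2, hence nonnegative. *)
Lemma fejer_defect_le1 M t : (0 < M)%N -> fejer_defect M t <= 1.
Proof.
move=> M0; rewrite ler_pdivrMl ?exprn_gt0 ?ltr0n// mulr1.
under eq_bigr do rewrite sumrB sumr_const card_ord.
rewrite sumrB sumr_const card_ord -mulrnA -natrX -mulnn lerBlDr lerDl.
rewrite [leRHS](_ : _ = (\sum_(i < M) cos (t * i%:R)) ^+ 2 +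
                        (\sum_(i < M) sin (t * i%:R)) ^+ 2).
  by rewrite addr_ge0 ?sqr_ge0.
rewrite !expr2 !big_distrl/= -big_split/=; apply: eq_bigr => i _.
rewrite !big_distrr/= -big_split/=; apply: eq_bigr => j _.
by rewrite rmorphB/= mulrBr cosB.
Qed.

(** Averages the finitely many bounds of [cos_defect_le]. The factor 1 - Re mu^ compensates the
    singularity of the resolvent as r -> 1. *)
Lemma fejer_defect_le M : exists C, forall t, fejer_defect M t <= C * (1 - a t).
Proof.
have /choice[D DP] : forall x : int,
    exists C, forall t, 1 - cos (t * x%:~R) <= C * (1 - a t).
  exact: cos_defect_le.
exists ((M%:R ^+ 2)^-1 * \sum_(i < M) \sum_(j < M) D (i%:Z - j%:Z)) => t.
rewrite -mulrA ler_wpM2l ?invr_ge0 ?sqr_ge0// mulr_suml; apply: ler_sum => i _.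
by rewrite mulr_suml; apply: ler_sum => j _; exact: DP.
Qed.

Lemma bmeas_fejer_defect M :
  bmeas (fejer_defect M : measurableTypeR R -> R).
Proof.
apply/bmeasZ/bmeas_sum => i; apply: bmeas_sum => j.
by apply: bmeasB; [exact: bmeas_cst|exact: bmeas_cos].
Qed.

Section averaged.
Variables (r : R) (r01 : 0 <= r < 1).
Let r_ge0 : 0 <= r. Proof. by case/andP: r01. Qed.
Let r_lt1 : r < 1. Proof. by case/andP: r01. Qed.

(** The sine terms at x and - x cancel. *)
Lemma resolvent_symmE x :
  2 * resolvent mu r 0 - resolvent mu r x - resolvent mu r (- x) =
  2 * \int[circle R]_t ((1 - cos (t * x%:~R)) * resolvent_re mu r t).
Proof.
have bi (y : int) := bmeas_resolvent_integrand mu r_ge0 r_lt1 y%:~R.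
rewrite -!expectationZ//; last first.
  apply: bmeasM; last exact: bmeas_resolvent_re.
  by apply: bmeasB; [exact: bmeas_cst|exact: bmeas_cos].
rewrite -expectationB//; last exact: bmeasZ.
rewrite -expectationB//; last by apply: bmeasB => //; exact: bmeasZ.
apply: eq_Rintegral => t _.
by rewrite rmorphN/= mulrN cosN sinN mulr0 cos0 sin0; ring.
Qed.

(** Mean of [resolvent_symm_ge] over x = i - j. The subtracted values add up to at most M N, which
    becomes N / M after division by M^2. *)
Lemma partial_green_le_fejer N M : (0 < M)%N ->
  partial_green mu r N 0 - N%:R / M%:R <=
  2 * \int[circle R]_t (fejer_defect M t * resolvent_re mu r t).
Proof.
move=> M0; have M0' : 0 < M%:R :> R by rewrite ltr0n.
have bre : bmeas (resolvent_re mu r : measurableTypeR R -> R).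
  exact: bmeas_resolvent_re.
have bd (i j : nat) : bmeas (fun t : measurableTypeR R =>
    (1 - cos (t * (i%:Z - j%:Z)%:~R)) * resolvent_re mu r t).
  by apply: bmeasM => //; apply: bmeasB; [exact: bmeas_cst|exact: bmeas_cos].
have -> : \int[circle R]_t (fejer_defect M t * resolvent_re mu r t) =
    (M%:R ^+ 2)^-1 * \sum_(i < M) \sum_(j < M) \int[circle R]_t
      ((1 - cos (t * (i%:Z - j%:Z)%:~R)) * resolvent_re mu r t).
  under [in RHS]eq_bigr do rewrite -expectation_sum//.
  rewrite -expectation_sum; last by move=> i; exact: bmeas_sum.
  rewrite -expectationZ; last by apply: bmeas_sum => i; exact: bmeas_sum.
  apply: eq_Rintegral => t _; rewrite -mulrA; congr (_ * _).
  rewrite mulr_suml; apply: eq_bigr => i _.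
  by rewrite mulr_suml.
rewrite mulrCA ler_pdivlMl ?exprn_gt0//.
rewrite mulr_sumr; under eq_bigr do rewrite mulr_sumr.
apply: (@le_trans _ _ (\sum_(i < M) \sum_(j < M)
  (partial_green mu r N 0 - partial_green mu r N (j%:Z - i%:Z)))); last first.
  apply: ler_sum => i _; apply: ler_sum => j _.
  by rewrite -resolvent_symmE -(opprB i%:Z) resolvent_symm_ge.
under eq_bigr do rewrite sumrB sumr_const card_ord.
rewrite sumrB sumr_const card_ord -mulrnA -[in leRHS]mulr_natl natrM -expr2.
rewrite mulrBr lerD2l lerN2.
rewrite [leRHS](_ : _ = \sum_(i < M) N%:R); last first.
  by rewrite sumr_const card_ord -mulr_natl; field; rewrite gt_eqF.
(* For fixed i, each of the N times n contributes at most 1, since r^n <= 1 and the points j - i are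
   distinct. *)
apply: ler_sum => i _; rewrite exchange_big/= -[N in leRHS]card_ord -sumr_const.
apply: ler_sum => n _; rewrite -mulr_sumr -[leRHS]mulr1.
rewrite ler_pM ?exprn_ge0 ?exprn_ile1 ?(ltW r_lt1) ?sum_step_prob_le1//.
by apply: sumr_ge0 => j _; exact: step_prob_ge0.
Qed.

End averaged.

End cosine_defect.

(** * The law of the walk *)

Section walk_law.
Context (R : realType) (mu : probability int R) d (T : measurableType d)
  (P : probability T R) (X : nat -> {RV P >-> int}).
Implicit Types (y z : int).

Lemma measurable_preimage_RV n (B : set int) : measurable (X n @^-1` B).
Proof. exact: measurable_funPTI. Qed.

Lemma bigcup_preimage_RV n (E : set T) :
  E = \bigcup_i (E `&` X n @^-1` pickle_fiber i).
Proof.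
rewrite -setI_bigcupr -preimage_bigcup bigcup_pickle_fiber.
by rewrite preimage_setT setIT.
Qed.

Lemma walk_step_set n y z :
  [set w | walk X n.+1 w = y] `&` X n @^-1` [set z] =
  [set w | walk X n w = y - z] `&` X n @^-1` [set z].
Proof.
apply/seteqP; split=> w [/= Sy Xz]; split => //.
  by rewrite -Sy /walk big_ord_recr/= Xz addrK.
by rewrite /walk big_ord_recr/= -/(walk X n w) Sy Xz subrK.
Qed.

Lemma measurable_walk n y : measurable [set w | walk X n w = y].
Proof.
elim: n y => [|n ih] y.
  have [->|y0] := eqVneq y 0.
    rewrite (_ : mkset _ = setT) //.
    by apply/seteqP; split=> // w _; rewrite /= /walk big_ord0.
  rewrite (_ : mkset _ = set0) //; apply/seteqP; split=> // w.
  by rewrite /= /walk big_ord0 => /esym/eqP; rewrite (negbTE y0).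
rewrite (bigcup_preimage_RV n [set w | walk X n.+1 w = y]).
apply: bigcupT_measurable => i.
have [->|[z ->]] := pickle_fiberP i; first by rewrite preimage_set0 setI0.
by rewrite walk_step_set; apply: measurableI => //; exact: measurable_preimage_RV.
Qed.

Hypothesis X_iid : iid_with_law X mu.

(* Events on future steps are carried along, so that the induction can absorb
   one step at a time into the independence hypothesis. *)
Lemma walk_prob_future n y (J : {fset nat}) (A : nat -> set int) :
  (forall j, j \in J -> (n <= j)%N) ->
  P ([set w | walk X n w = y] `&` \bigcap_(j in [set` J]) (X j @^-1` A j)) =
  ((step_prob mu n y)%:E * \prod_(j <- J) mu (A j))%E.
Proof.
have [indep law] := X_iid.
elim: n y J A => [|n ih] y J A nJ /=.
  have [->|y0] := eqVneq y 0.
    rewrite (_ : mkset _ = setT); last first.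
      by apply/seteqP; split=> // w _; rewrite /= /walk big_ord0.
    rewrite setTI mul1e indep//; apply: eq_bigr => j _.
    exact: law.
  rewrite mul0e (_ : mkset _ = set0) ?set0I ?measure0//; apply/seteqP; split=> // w.
  by rewrite /= /walk big_ord0 => /esym/eqP; rewrite (negbTE y0).
set F := \bigcap_(j in _) _.
have mF : measurable F.
  apply: fin_bigcap_measurable; first exact: finite_fset.
  by move=> j _; exact: measurable_preimage_RV.
set c := (\prod_(j <- J) mu (A j))%E.
have cfin : c \is a fin_num by apply: prode_fin_num => j _; exact: fin_num_measure.
(* The event is cut along the countably many values z of [X n]; the convolution on the right is
   expanded over the same z. *)
rewrite (bigcup_preimage_RV n (_ `&` F)) measure_bigcup; last 2 first.
- move=> i _; apply: measurableI; last exact: measurable_preimage_RV.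
  by apply: measurableI => //; exact: measurable_walk.
- move=> i j _ _ [w [[_ /= wi] [_ /= wj]]].
  by apply: trivIset_pickle_fiber => //; exists (X n w).
rewrite EFin_Rintegral; last exact/bounded_bmeas_conv/bounded_step_prob.
rewrite ge0_integral_int => [|z]; last by rewrite lee_fin step_prob_ge0.
rewrite muleC -[c]fineK// -nneseriesZl; last first.
  by move=> i _; apply: integral_ge0 => z _; rewrite lee_fin step_prob_ge0.
rewrite (eq_eseriesl (Q := xpredT)) => [|i]; last by rewrite in_setT.
apply: eq_eseriesr => i _.
have [->|[z ->]] := pickle_fiberP i.
  by rewrite preimage_set0 setI0 measure0 integral_set0 mule0.
rewrite integral_int1 fineK//.
(* The event that [X n] equals z joins the future events for the induction hypothesis; n is not in
   J, whose elements are at least n + 1. *)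
pose A' j := if j == n then [set z] else A j.
have nJ' : n \notin J by apply/negP => /nJ; rewrite ltnn.
rewrite (_ : _ `&` _ = [set w | walk X n w = y - z] `&`
    \bigcap_(j in [set` (n |` J)%fset]) (X j @^-1` A' j)); last first.
  rewrite set_fsetU1 bigcap_setU1 {1}/A' eqxx setIA -walk_step_set setIAC.
  congr (_ `&` _); apply: eq_bigcapr => j jJ; rewrite /A' ifF//.
  by apply/negP => /eqP jn; rewrite /= jn (negbTE nJ') in jJ.
rewrite [LHS](ih (y - z) (n |` J)%fset A'); last first.
  move=> j; rewrite !inE => /orP[/eqP ->//|/nJ]; exact: ltnW.
rewrite big_fsetU1//= [in X in (_ * X)%E]/A' eqxx.
rewrite (_ : (\prod_(j <- J) mu (A' j))%E = c); last first.
  rewrite /c !big_seq; apply: eq_bigr => j jJ; rewrite /A' ifF//.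
  by apply/negP => /eqP jn; rewrite jn (negbTE nJ') in jJ.
by rewrite muleA muleC.
Qed.

Lemma walk_prob n y : P [set w | walk X n w = y] = (step_prob mu n y)%:E.
Proof.
have := @walk_prob_future n y fset0 (fun=> setT).
rewrite big_seq_fset0 mule1 => <-//.
by rewrite set_fset0 bigcap_set0 setIT.
Qed.

End walk_law.

(** * The limit r -> 1 *)

Section abel_limit.
Context (R : realType) (mu : probability int R).
Local Notation a := (char_re mu).

(** A concrete sequence in [0, 1) tending to 1, since the convergence theorems are applied along
    sequences. *)
Definition abel (n : nat) : R := 1 - harmonic n.

Lemma abel01 n : 0 <= abel n < 1.
Proof.
rewrite /abel /harmonic/= subr_ge0 invf_le1 ?ltr0n// ler1n /=.
by rewrite ltrBlDr ltrDl invr_gt0 ltr0n.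
Qed.

Lemma cvg_abel : abel @ \oo --> (1 : R).
Proof.
rewrite -[X in _ --> X]subr0; apply: cvgB; first exact: cvg_cst.
exact: cvg_harmonic.
Qed.

Lemma cvg_partial_green N x :
  partial_green mu (abel n) N x @[n --> \oo] --> partial_green mu 1 N x.
Proof.
have cvgX k : abel n ^+ k @[n --> \oo] --> (1 : R) ^+ k.
  elim: k => [|k ih]; first by under eq_fun do rewrite expr0; exact: cvg_cst.
  by under eq_fun do rewrite exprS; rewrite exprS; apply: cvgM => //; exact: cvg_abel.
rewrite /partial_green; elim: N => [|N ih].
  by under eq_fun do rewrite big_ord0; rewrite big_ord0; exact: cvg_cst.
under eq_fun do rewrite big_ord_recr/=; rewrite big_ord_recr/=.
by apply: cvgD => //; apply: cvgMr_tmp; exact: cvgX.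
Qed.

Lemma cvg_resolvent_re t : a t != 1 ->
  resolvent_re mu (abel n) t @[n --> \oo] --> resolvent_re mu 1 t.
Proof.
move=> a1; have num_cvg : 1 - abel n * a t @[n --> \oo] --> 1 - 1 * a t.
  by apply: cvgB; [exact: cvg_cst|apply: cvgMr_tmp; exact: cvg_abel].
apply: cvgM => //; apply: cvgV.
  rewrite gt_eqF// ltr_wpDr ?sqr_ge0// exprn_even_gt0//= mul1r subr_eq0.
  by rewrite eq_sym.
apply: cvgD; rewrite expr2; under eq_fun do rewrite expr2; apply: cvgM => //;
  by apply: cvgMr_tmp; exact: cvg_abel.
Qed.

(** The bound uniform in r behind the dominated convergence: with 1 - r a in place of 1 - a the
    product is at most 1, its numerator being one of the two squares in the denominator. *)
Lemma mulr_resolvent_re_le2 r t : 0 <= r < 1 ->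
  (1 - a t) * resolvent_re mu r t <= 2.
Proof.
move=> /andP[r0 r1].
have den_ge := resolvent_den_ge mu r0 r1 t.
have re_le : (1 - r * a t) * resolvent_re mu r t <= 1.
  rewrite mulrA ler_pdivrMr; last first.
    by rewrite (lt_le_trans _ den_ge)// exprn_gt0// subr_gt0.
  by rewrite mul1r -expr2 lerDl sqr_ge0.
have re0 : 0 <= resolvent_re mu r t by rewrite resolvent_re_ge0// r0 ltW.
(* Equivalent to (2 r - 1) a <= 1, where both factors lie in [-1, 1]. *)
have a_le : 1 - a t <= 2 * (1 - r * a t).
  have := char_re_le1 mu t; have := char_re_geN1 mu t; nra.
by rewrite (le_trans (ler_wpM2r re0 a_le))// -mulrA -[leRHS]mulr1 ler_wpM2l.
Qed.

Lemma resolvent_re1_eq0 t : a t = 1 -> resolvent_re mu 1 t = 0.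
Proof. by rewrite /resolvent_re => ->; rewrite mulr1 subrr mul0r. Qed.

Lemma measurable_resolvent_re r :
  measurable_fun setT (resolvent_re mu r : measurableTypeR R -> R).
Proof.
apply: measurable_funM; first by have [] := bmeas_num_re mu r.
apply: measurable_inv_ge0; first by have [] := bmeas_den mu r.
by move=> t; rewrite addr_ge0 ?sqr_ge0.
Qed.

Let L := (\int[circle R]_t (resolvent_re mu 1 t)%:E)%E.

Let resolvent_re1_ge0 t : 0 <= resolvent_re mu 1 t.
Proof. by rewrite resolvent_re_ge0// lexx ler01. Qed.

(** Fatou's lemma along [abel]: the integrals of the approximants are the numbers
    [resolvent mu r 0], all at most G. *)
Lemma integral_resolvent_re_le (G : \bar R) :
  (forall r, 0 <= r < 1 -> ((resolvent mu r 0)%:E <= G)%E) -> (L <= G)%E.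
Proof.
move=> uG.
have re_ge0 n t : 0 <= resolvent_re mu (abel n) t.
  by have /andP[r0 r1] := abel01 n; rewrite resolvent_re_ge0// r0 ltW.
have le_fatou : (L <= \int[circle R]_t
    limn_einf (fun n => (resolvent_re mu (abel n) t)%:E))%E.
  apply: ge0_le_integral => //.
  - by move=> t _; rewrite lee_fin.
  - by apply/measurable_EFinP; exact: measurable_resolvent_re.
  - apply: (emeasurable_fun_cvg
        (fun n t => einfs (fun m => (resolvent_re mu (abel m) t)%:E) n)).
      move=> n; apply: (measurable_fun_einfs
        (f := fun m t => (resolvent_re mu (abel m) t)%:E)) => m.
      by apply/measurable_EFinP; exact: measurable_resolvent_re.
    move=> t _; rewrite limn_einf_lim.
    by apply: ereal_nondecreasing_is_cvgn; exact: nondecreasing_einfs.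
  (* where a t = 1, the left-hand side takes the junk value 0 *)
  move=> t _; have [a1|a1] := eqVneq (a t) 1.
    rewrite resolvent_re1_eq0// limn_einf_lim; apply: lime_ge.
      by apply: ereal_nondecreasing_is_cvgn; exact: nondecreasing_einfs.
    apply: nearW => n; apply: le_ereal_inf_tmp => _ [m _ <-].
    by rewrite lee_fin.
  have cvg_re : (resolvent_re mu (abel n) t)%:E @[n --> \oo] -->
      (resolvent_re mu 1 t)%:E.
    by apply: cvg_EFin; [exact: nearW|exact: cvg_resolvent_re].
  by rewrite (cvg_limn_einf_sup cvg_re).1.
apply: (le_trans le_fatou); apply: le_trans (fatou _ _ _ _) _ => //.
- by move=> n; apply/measurable_EFinP; exact: measurable_resolvent_re.
- by move=> n t _; rewrite lee_fin.
rewrite limn_einf_lim; apply: lime_le.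
  by apply: ereal_nondecreasing_is_cvgn; exact: nondecreasing_einfs.
apply: nearW => n.
have /andP[r0 r1] := abel01 n.
apply: le_trans (uG _ (abel01 n)).
apply: ereal_inf_lbound; exists n => //=.
by rewrite resolvent0 EFin_Rintegral//; exact: bmeas_resolvent_re.
Qed.

Hypothesis mu_gcd : is_gcd (supp mu) 1.

(** [partial_green_le_fejer] passes to the limit by dominated convergence; the factor
    [fejer_defect], at most 1, is dropped only in the limit, once it has served for the
    domination. *)
Lemma partial_green1_le_integral N M : (0 < M)%N ->
  ((partial_green mu 1 N 0 - N%:R / M%:R)%:E <= 2%:E * L)%E.
Proof.
move=> M0.
pose f n t := (fejer_defect M t * resolvent_re mu (abel n) t)%:E.
pose f1 t := (fejer_defect M t * resolvent_re mu 1 t)%:E.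
have [C CP] := fejer_defect_le mu_gcd M.
have mf r : measurable_fun setT (fun t : measurableTypeR R =>
    (fejer_defect M t * resolvent_re mu r t)%:E).
  apply/measurable_EFinP; apply: measurable_funM; last exact: measurable_resolvent_re.
  by have [] := bmeas_fejer_defect R M.
have fcvg : (\int[circle R]_t f n t @[n --> \oo] --> \int[circle R]_t f1 t)%E.
  apply: (@dominated_cvg _ _ _ (circle R) setT measurableT f f1 (fun=> (2 * `|C|)%:E)) => //.
  - by move=> n; exact: mf.
  - move=> t _; rewrite /f /f1; apply: cvg_EFin; first exact: nearW.
    have [a1|a1] := eqVneq (a t) 1.
      (* Where a t = 1 the resolvent may blow up as r -> 1, but the other factor vanishes there. *)
      have fd0 : fejer_defect M t = 0.
        apply/eqP; rewrite eq_le fejer_defect_ge0 andbT.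
        by have := CP t; rewrite a1 subrr mulr0.
      by rewrite /= fd0 mul0r; under eq_fun do rewrite mul0r; exact: cvg_cst.
    by apply: cvgMl_tmp; exact: cvg_resolvent_re.
  - exact: (@finite_measure_integrable_cst _ _ _ (circle R) setT (2 * `|C|)).
  - move=> n t _; rewrite /f abse_EFin lee_fin.
    have /andP[r0 r1] := abel01 n.
    have re0 : 0 <= resolvent_re mu (abel n) t by rewrite resolvent_re_ge0// r0 ltW.
    rewrite ger0_norm; last by apply: mulr_ge0 => //; exact: fejer_defect_ge0.
    (* The dominating constant 2 |C| combines [fejer_defect] <= |C| (1 - a) with the bound 2 for (1
       - a) times the resolvent. *)
    apply: (@le_trans _ _ (`|C| * ((1 - a t) * resolvent_re mu (abel n) t))).
      rewrite [leRHS]mulrA; apply: ler_wpM2r => //; apply: le_trans (CP t) _.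
      by apply: ler_wpM2r (ler_norm C); rewrite subr_ge0 char_re_le1.
    by rewrite [leRHS]mulrC; apply: ler_wpM2l => //; exact: mulr_resolvent_re_le2 (abel01 n).
have f1L : (\int[circle R]_t f1 t <= L)%E.
  apply: ge0_le_integral => //.
  - by move=> t _; rewrite lee_fin; apply: mulr_ge0 => //; exact: fejer_defect_ge0.
  - exact: mf.
  - by apply/measurable_EFinP; exact: measurable_resolvent_re.
  - by move=> t _; rewrite lee_fin ler_piMl// fejer_defect_le1.
apply: (@le_trans _ _ (2%:E * \int[circle R]_t f1 t)%E); last first.
  by rewrite lee_wpmul2l// lee_fin.
have gcvg : (partial_green mu (abel n) N 0 - N%:R / M%:R)%:E @[n --> \oo] -->
    (partial_green mu 1 N 0 - N%:R / M%:R)%:E.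
  apply: cvg_EFin; first exact: nearW.
  by apply: cvgB; [exact: cvg_partial_green|exact: cvg_cst].
have hcvg : (2%:E * \int[circle R]_t f n t @[n --> \oo] -->
    2%:E * \int[circle R]_t f1 t)%E.
  exact: cvgeZl.
rewrite -(cvg_lim _ gcvg)// -(cvg_lim _ hcvg)//; apply: lee_lim.
- by apply/cvg_ex; eexists; exact: gcvg.
- by apply/cvg_ex; eexists; exact: hcvg.
apply: nearW => n.
have /andP[r0 r1] := abel01 n.
rewrite /f -EFin_Rintegral; last first.
  by apply: bmeasM; [exact: bmeas_fejer_defect|exact: bmeas_resolvent_re].
by rewrite -EFinM lee_fin partial_green_le_fejer// abel01.
Qed.

Lemma partial_green1_le N : ((partial_green mu 1 N 0)%:E <= 2%:E * L)%E.
Proof.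
apply/lee_addgt0Pr => e e0.
have [M [M0 NM]] : exists M, (0 < M)%N /\ N%:R / M%:R <= e.
  (* Any M > N / e makes the averaging error N / M at most e. *)
  exists (Num.truncn (N%:R / e)).+1; split=> //.
  rewrite ler_pdivrMr ?ltr0n// mulrC -ler_pdivrMr//.
  by rewrite ltW// truncnS_gt.
rewrite -leeBlDr// -EFinB (le_trans _ (partial_green1_le_integral N M0))//.
by rewrite lee_fin lerD2l lerN2.
Qed.

End abel_limit.

(** * Comparison with the Green function *)

Section green_function.
Context (R : realType) (mu : probability int R) d (T : measurableType d)
  (P : probability T R) (X : nat -> {RV P >-> int}).
Hypothesis X_iid : iid_with_law X mu.

Lemma partial_green1E N :
  (partial_green mu 1 N 0)%:E = (\sum_(0 <= n < N) P [set w | walk X n w = 0%R])%E.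
Proof.
rewrite big_mkord /partial_green -sumEFin; apply: eq_bigr => n _.
by rewrite expr1n mul1r (walk_prob X_iid).
Qed.

(** The remainder r^N C of [resolvent_le_partial_green] tends to 0, and replacing r^n by 1 only
    increases the partial sum. *)
Lemma resolvent0_le_green r : 0 <= r < 1 -> ((resolvent mu r 0)%:E <= green00 X)%E.
Proof.
move=> r01; have /andP[r0 r1] := r01.
have [C uC] := resolvent_bounded mu r0 r1.
have cvg0 : geometric C r @ \oo --> (0 : R).
  by apply: cvg_geometric; rewrite ger0_norm.
apply/lee_addgt0Pr => e e0.
have : \forall N \near \oo, geometric C r N < e by apply: cvgr_lt cvg0 _ _.
move=> [N _ /(_ N (leqnn _))]; rewrite /geometric/= mulrC => rNe.
have uN := @resolvent_le_partial_green _ mu r r01 C N 0 uC.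
apply: (@le_trans _ _ ((partial_green mu 1 N 0)%:E + e%:E)%E).
  rewrite lee_fin (le_trans uN)// lerD ?(ltW rNe)//.
  apply: ler_sum => n _; rewrite ler_wpM2r ?step_prob_ge0// expr1n.
  by rewrite exprn_ile1 ?(ltW r1).
rewrite leeD2r// partial_green1E; exact: nneseries_lim_ge.
Qed.

End green_function.

Unset Implicit Arguments.

Theorem proposition3p2 (R : realType) (mu : probability int R)
    (mu_not_dirac : ~ is_dirac mu)
    (mu_gcd : is_gcd (supp mu) 1)
    (d : measure_display) (T : measurableType d) (P : probability T R)
    (X : nat -> {RV P >-> int}) (X_iid : iid_with_law X mu) :
  let I := (\int[lebesgue_measure]_(t in `]0%R, (2 * pi)%R[)
              (complex.Re (1 / (1 - fourier mu t)))%:E)%E in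
  (green00 X <= (1 / pi)%:E * I)%E /\
  ((1 / pi)%:E * I <= 2%:E * green00 X)%E.
Proof.
move=> I; have re1_ge0 t : 0 <= resolvent_re mu 1 t.
  by rewrite resolvent_re_ge0// lexx ler01.
(* 1 / pi is twice the density 1 / (2 pi) of the law [circle], whence the factor 2. *)
have -> : ((1 / pi)%:E * I = 2%:E * \int[circle R]_t (resolvent_re mu 1 t)%:E)%E.
  rewrite integral_circle//; last exact: measurable_resolvent_re.
  rewrite muleA -EFinM; congr (_%:E * _)%E.
    by rewrite invfM mulrA divff// pnatr_eq0.
  apply: eq_integral => t _; rewrite Re_inv_fourier.
  by rewrite /resolvent_re /resolvent_den !mul1r.
split.
  (* Each partial sum of the Green series is a [partial_green] at r = 1, so a bound uniform in N
     suffices. *)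
  apply: lime_le; first by apply: is_cvg_nneseries.
  apply: nearW => N.
  by rewrite -(partial_green1E X_iid) partial_green1_le.
rewrite lee_wpmul2l ?lee_fin//; apply: integral_resolvent_re_le => r r01.
exact: resolvent0_le_green.
Qed.
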